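(* Let $\ell\ge3$, let $\widetilde C$ be an orientation of $C_\ell$ that is not a directed cycle, let $0<\mu\le10^{-2}$, let $0<d\ll\mu^2$, $0<\varepsilon\ll d^4,\mu^2,1/\ell$, let $M\ge M_0>3$ be integers, let $\gamma>0$ be sufficiently small in terms of $\ell,\mu,d,\varepsilon,M$, and let $n_0$ be sufficiently large in terms of all these. Let $D$ be an oriented graph of order $n\ge n_0$ with $\sigma_{\mathrm{Ore}}^*(D)\ge(\frac34+\mu)n$ and $\alpha(D)\le\gamma n$. Take an $(\varepsilon,d)$-regularity partition $V_0,V_1,\dots,V_k$ of $D$ with pure digraph $D'$ and cluster size $m$, a partner map $f$, and the associated bad set $E_{\mathrm{bad}}$. Then $D$ has a $\widetilde C$-tiling $\mathcal F_E$ satisfying: (i) every copy in $\mathcal F_E$ contains exactly one vertex of $E_{\mathrm{bad}}$, and $E_{\mathrm{bad}}\subseteq V(\mathcal F_E)$; (ii) $|V(\mathcal F_E)|=\ell|E_{\mathrm{bad}}|\le2\ell\varepsilon n\le\sqrt\varepsilon\,n$; (iii) for every $i\in[k]$, $|V(\mathcal F_E)\cap V_i|\le3\sqrt\varepsilon\,m$.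
   Context: Notation $a\ll b$: $a$ is chosen sufficiently small in terms of $b$ (i.e. there is a positive function $\phi$ such that the statement holds whenever $0<a\le\phi(b)$). An oriented graph is a finite loopless digraph with at most one arc between any two vertices. $\alpha(D)$ is the independence number of the underlying undirected graph. $d_D^*(v):=\max\{d_D^+(v),d_D^-(v)\}$, and $\sigma_{\mathrm{Ore}}^*(D):=\min\{d_D^*(x)+d_D^*(y):x\ne y,\ xy,yx\notin A(D)\}$, with value $\infty$ if the underlying graph is complete. $P^+:=\{v\in V(D):d_D^+(v)\ge d_D^-(v)\}$, $P^-:=V(D)\setminus P^+$ (either may be empty). A $\widetilde C$-tiling is a set of pairwise vertex-disjoint copies of $\widetilde C$; $V(\mathcal F)$ is the set of vertices covered by a tiling $\mathcal F$. For disjoint vertex sets $X,Y$, $d_{D'}(X,Y)$ is the number of arcs of $D'$ from $X$ to $Y$ divided by $|X||Y|$; $(X,Y)$ is $\varepsilon$-regular if $|d_{D'}(X',Y')-d_{D'}(X,Y)|<\varepsilon$ for all $X'\subseteq X$, $Y'\subseteq Y$ with $|X'|\ge\varepsilon|X|$, $|Y'|\ge\varepsilon|Y|$. An $(\varepsilon,d)$-regularity partition of $D$ with pure digraph $D'$ (the output of the degree form of the diregularity lemma applied with initial partition $(P^+,P^-)$) is a partition $V(D)=V_0\cup V_1\cup\dots\cup V_k$ and a spanning subdigraph $D'\subseteq D$ such that: $M_0\le k\le M$, $|V_0|\le\varepsilon n$, $|V_1|=\dots=|V_k|=:m$; each $V_i$, $i\in[k]$, is contained in $P^+$ or in $P^-$;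 $D'[V_i]$ has no arcs for each $i\in[k]$ and all vertices of $V_0$ are isolated in $D'$; $d_{D'}^{\pm}(v)\ge d_D^{\pm}(v)-(d+2\varepsilon)n$ for every $v\in V(D)\setminus V_0$; for all distinct $i,j\in[k]$, $(V_i,V_j)$ is $\varepsilon$-regular in $D'$ with density $p_{(i,j)}:=d_{D'}(V_i,V_j)$ either $0$ or at least $d$. A partner map is a map $f:[k]\to[k]$ with $f(i)\ne i$ such that $p_{(i,f(i))}\ge d$ whenever $V_i\subseteq P^+$ and $p_{(f(i),i)}\ge d$ whenever $V_i\subseteq P^-$ (such a map exists under the stated hypotheses). Put $B_i:=\{x\in V_i:d_{D'}^+(x,V_{f(i)})<(p_{(i,f(i))}-\varepsilon)m\}$ if $V_i\subseteq P^+$, and $B_i:=\{x\in V_i:d_{D'}^-(x,V_{f(i)})<(p_{(f(i),i)}-\varepsilon)m\}$ if $V_i\subseteq P^-$, where $d^{\pm}_{D'}(x,Y)$ counts out-/in-neighbours of $x$ in $Y$. The bad set is $E_{\mathrm{bad}}:=V_0\cup\bigcup_{i\in[k]}B_i$. *)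

(* Defs.v *)
From mathcomp Require Import all_boot all_order all_fingroup all_algebra.
From mathcomp Require Import reals constructive_ereal.

Set Implicit Arguments.
Unset Strict Implicit.
Unset Printing Implicit Defensive.

Import Order.TTheory GRing.Theory Num.Theory.

Local Open Scope ring_scope.

(* A digraph on the vertex set T is its arc relation D : rel T. *)

Section Digraphs.
Variables (T : finType) (D : rel T).

Definition oriented_graph : Prop :=
  irreflexive D /\ forall x y, ~~ (D x y && D y x).

Definition adjacent : rel T := [rel x y | D x y || D y x].

Definition independence_number : nat :=
  \max_(A : {set T} | [forall x in A, forall y in A, ~~ adjacent x y]) #|A|.

Definition outdeg_in (x : T) (Y : {set T}) : nat := #|[set y in Y | D x y]|.
Definition indeg_in (x : T) (Y : {set T}) : nat := #|[set y in Y | D y x]|.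

Definition outdeg (x : T) : nat := outdeg_in x setT.
Definition indeg (x : T) : nat := indeg_in x setT.

Definition dstar (x : T) : nat := maxn (outdeg x) (indeg x).

Definition Pplus : {set T} := [set v | (indeg v <= outdeg v)%N].
Definition Pminus : {set T} := ~: Pplus.

Variable R : realType.

Definition sigma_Ore : \bar R :=
  \big[Order.min/+oo%E]_(p : T * T | (p.1 != p.2) && ~~ adjacent p.1 p.2)
    ((dstar p.1 + dstar p.2)%N%:R)%:E.

Definition density (X Y : {set T}) : R :=
  #|[set p in setX X Y | D p.1 p.2]|%:R / (#|X|%:R * #|Y|%:R).

Definition eps_regular (eps : R) (X Y : {set T}) : Prop :=
  forall X' Y' : {set T}, X' \subset X -> Y' \subset Y ->
    eps * #|X|%:R <= #|X'|%:R -> eps * #|Y|%:R <= #|Y'|%:R ->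
    `|density X' Y' - density X Y| < eps.

End Digraphs.

Section Cycles.
Variables (l : nat) (C : rel 'I_l).

(* The underlying graph is the cycle 0, 1, ..., l-1, 0; ordS is the cyclic
   successor on 'I_l. *)
Definition cycle_orientation : Prop :=
  oriented_graph C /\
  forall i j, adjacent C i j = (j == ordS i) || (i == ordS j).

(* C is isomorphic to the digraph with arc set {(i, i+1 mod l)}. *)
Definition directed_cycle : Prop :=
  exists s : {perm 'I_l}, forall i j, C (s i) (s j) = (j == ordS i).

Variables (T : finType) (D : rel T).

(* A (not necessarily induced) copy of C in D is given by an embedding of C. *)
Definition copy (phi : {ffun 'I_l -> T}) : Prop :=
  injective phi /\ forall i j, C i j -> D (phi i) (phi j).

Definition copy_vertices (phi : {ffun 'I_l -> T}) : {set T} :=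
  [set phi i | i : 'I_l].

(* For l > 0, two embeddings with the same image are not disjoint, so a tiling
   contains at most one embedding for each copy of C. *)
Definition tiling (F : {set {ffun 'I_l -> T}}) : Prop :=
  (forall phi, phi \in F -> copy phi) /\
  (forall phi psi, phi \in F -> psi \in F -> phi != psi ->
     [disjoint copy_vertices phi & copy_vertices psi]).

Definition tiling_vertices (F : {set {ffun 'I_l -> T}}) : {set T} :=
  \bigcup_(phi in F) copy_vertices phi.

End Cycles.

Section Regularity.
Variables (R : realType) (T : finType) (D D' : rel T).
Variables (eps d : R) (M0 M k m : nat) (V0 : {set T}) (V : 'I_k -> {set T}).

Record regularity_partition : Prop := RegularityPartition {
  rp_number : (M0 <= k <= M)%N;
  rp_cover : V0 :|: \bigcup_i V i = setT;
  rp_disjoint0 : forall i, [disjoint V0 & V i];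
  rp_disjoint : forall i j, i != j -> [disjoint V i & V j];
  rp_exceptional : #|V0|%:R <= eps * #|T|%:R;
  rp_size : forall i, #|V i| = m;
  rp_refines : forall i, (V i \subset Pplus D) || (V i \subset Pminus D);
  rp_sub : subrel D' D;
  rp_inside : forall i x y, x \in V i -> y \in V i -> ~~ D' x y;
  rp_isolated : forall x y, x \in V0 -> ~~ adjacent D' x y;
  rp_outdeg : forall x, x \notin V0 ->
    (outdeg D x)%:R - (d + 2 * eps) * #|T|%:R <= (outdeg D' x)%:R;
  rp_indeg : forall x, x \notin V0 ->
    (indeg D x)%:R - (d + 2 * eps) * #|T|%:R <= (indeg D' x)%:R;
  rp_regular : forall i j, i != j -> eps_regular D' eps (V i) (V j);
  rp_density : forall i j, i != j ->
    density D' R (V i) (V j) = 0 \/ d <= density D' R (V i) (V j)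
}.

Variable f : 'I_k -> 'I_k.

Definition partner_map : Prop :=
  forall i, [/\ f i != i,
    V i \subset Pplus D -> d <= density D' R (V i) (V (f i)) &
    V i \subset Pminus D -> d <= density D' R (V (f i)) (V i)].

Definition bad_in (i : 'I_k) : {set T} :=
  [set x in V i |
     (V i \subset Pplus D) &&
       ((outdeg_in D' x (V (f i)))%:R
          < (density D' R (V i) (V (f i)) - eps) * m%:R)
  || (V i \subset Pminus D) &&
       ((indeg_in D' x (V (f i)))%:R
          < (density D' R (V (f i)) (V i) - eps) * m%:R)].

Definition bad_set : {set T} := V0 :|: \bigcup_i bad_in i.

End Regularity.

(* Main.v *)
(* A non-directed orientation of a cycle has a source and a sink.  By the Ore
   condition every vertex v has linear d^*(v), so, say, N^+(v) is of linear
   size; after removing the vertices that may not be used it still is, and an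
   independence number o(n) forces every oriented path on l - 1 vertices inside
   it (as in Burr's theorem on oriented trees).  Such a path together with v as
   a source is a copy of the cycle.  Bad vertices are covered greedily in this
   way, and a cluster is retired once it has received about sqrt(eps) m
   vertices, which can happen to clusters covering at most 2 l sqrt(eps) n
   vertices. *)
Require Import Defs.
From mathcomp Require Import all_boot all_order all_fingroup all_algebra.
From mathcomp Require Import reals constructive_ereal.
From mathcomp Require Import zify ring lra.

Set Implicit Arguments.
Unset Strict Implicit.
Unset Printing Implicit Defensive.

Import Order.TTheory GRing.Theory Num.Theory.

Local Open Scope ring_scope.

(** * Degrees, double counting and independent sets *)

Definition converse (T : Type) (D : rel T) : rel T := fun x y => D y x.

Section Degrees.
Variables (T : finType) (D : rel T).
Implicit Types (A B X Y : {set T}).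

Lemma adjacent_sym x y : adjacent D x y = adjacent D y x.
Proof. by rewrite /adjacent /= orbC. Qed.

Lemma adjacent_converse x y : adjacent (converse D) x y = adjacent D x y.
Proof. by rewrite /adjacent /converse /= orbC. Qed.

Lemma outdeg_inE x Y : outdeg_in D x Y = (\sum_(y in Y) D x y)%N.
Proof.
rewrite /outdeg_in -sum1_card (eq_bigl (fun y => (y \in Y) && D x y)); last first.
  by move=> y; rewrite inE.
by rewrite big_mkcondr; apply: eq_bigr => y _; case: (D x y).
Qed.

Lemma outdeg_inU x X Y :
  (outdeg_in D x (X :|: Y) <= outdeg_in D x X + outdeg_in D x Y)%N.
Proof.
rewrite /outdeg_in; apply: leq_trans (leq_card_setU _ _).
by apply: subset_leq_card; apply/subsetP=> y; rewrite !inE andb_orl.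
Qed.

Lemma outdeg_in_le x Y : (outdeg_in D x Y <= #|Y|)%N.
Proof. by apply: subset_leq_card; apply/subsetP=> y; rewrite inE => /andP[]. Qed.

Lemma outdeg_in_leS x X Y : X \subset Y -> (outdeg_in D x X <= outdeg_in D x Y)%N.
Proof.
move=> sXY; apply: subset_leq_card; apply/subsetP=> y.
by rewrite !inE => /andP[/(subsetP sXY) -> ->].
Qed.

End Degrees.

Section DoubleCounting.
Variables (T : finType) (D : rel T).
Implicit Types (A B X Y : {set T}).

Lemma indeg_in_converse x Y : indeg_in D x Y = outdeg_in (converse D) x Y.
Proof. by []. Qed.

Lemma double_count X Y :
  (\sum_(x in X) outdeg_in D x Y = \sum_(y in Y) indeg_in D y X)%N.
Proof.
under eq_bigr do rewrite outdeg_inE.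
rewrite exchange_big /=; apply: eq_bigr => y _.
by rewrite indeg_in_converse outdeg_inE.
Qed.

(** In- and out-degrees inside [A] have the same sum, and each ordered pair of vertices adds at most
    one to the two together. *)
Lemma sum_outdeg_in_self A : oriented_graph D ->
  (2 * \sum_(x in A) outdeg_in D x A <= #|A| * #|A|)%N.
Proof.
move=> [_ oD]; rewrite mul2n -addnn {2}double_count -big_split /= -sum_nat_const.
apply: leq_sum => x _; rewrite indeg_in_converse !outdeg_inE -big_split /= -sum1_card.
by apply: leq_sum => y _; have := oD x y; rewrite /converse; case: (D x y) (D y x) => [] [].
Qed.

(** Averaging yields a vertex of in-degree at most [q] inside [B]. It joins the independent set, it
    and its at most [2 * q] neighbours are deleted, and the rest is treated alike. *)
Lemma independent_of_bounded_outdeg q B : irreflexive D ->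
  (forall x, x \in B -> outdeg_in D x B <= q)%N ->
  exists I : {set T}, [/\ I \subset B,
    (forall x y, x \in I -> y \in I -> ~~ adjacent D x y) &
    (#|B| <= (2 * q).+1 * #|I|)%N].
Proof.
move=> iD; have [b] := ubnP #|B|; elim: b B => // b IHb B; rewrite ltnS => leBb degB.
have [->|B0] := eqVneq B set0.
  by exists set0; split=> [|x y|]; rewrite ?sub0set ?inE ?cards0 ?muln0.
have [x xB degx]: exists2 x, x \in B & (indeg_in D x B <= q)%N.
  apply/exists_inP; apply: contraT => /exists_inPn /= inB.
  have := double_count B B; apply: contra_eqT => _; rewrite neq_ltn; apply/orP; left.
  apply: (@leq_trans (q.+1 * #|B|)).
    apply: (@leq_ltn_trans (\sum_(x in B) q)); first exact: leq_sum.
    by rewrite sum_nat_const mulSn mulnC -[ltnLHS]add0n ltn_add2r card_gt0.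
  rewrite mulnC -sum_nat_const; apply: leq_sum => x xB.
  by rewrite ltnNge; apply: inB.
pose N := x |: ([set y in B | D x y] :|: [set y in B | D y x]).
have cN : (#|N| <= (2 * q).+1)%N.
  have h1 : (#|[set y in B | D x y] :|: [set y in B | D y x]| <= q + q)%N.
    by apply: leq_trans (leq_card_setU _ _) _; rewrite leq_add // degB.
  rewrite mul2n -addnn -add1n; apply: leq_trans (leq_add (leqnn 1) h1).
  by rewrite -(cards1 x) leq_card_setU.
have xN : x \in N by rewrite !inE eqxx.
have cB : (#|B| <= #|N| + #|B :\: N|)%N.
  by rewrite -(cardsID N B) leq_add2r subset_leq_card // subsetIr.
have [||I [sIB indI cI]] := IHb (B :\: N).
- apply: leq_trans leBb; apply: proper_card; apply/properP; split; first exact: subsetDl.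
  by exists x => //; rewrite inE xN.
- move=> y /setDP[yB _]; apply: leq_trans (degB _ yB).
  by apply: outdeg_in_leS; exact: subsetDl.
have nIx y : y \in I -> ~~ adjacent D x y.
  move=> /(subsetP sIB)/setDP[yB]; rewrite !inE yB !negb_or /= => /and3P[_ h1 h2].
  by rewrite /adjacent /= (negPf h1) (negPf h2).
exists (x |: I); split.
- by rewrite subUset sub1set xB (subset_trans sIB) ?subsetDl.
- move=> y z /setU1P[->|yI] /setU1P[->|zI].
  + by rewrite /adjacent /= iD.
  + exact: nIx.
  + by rewrite adjacent_sym nIx.
  + exact: indI.
- rewrite cardsU1 mulnDr; apply: leq_trans cB _.
  have -> : x \notin I by apply/negP=> /(subsetP sIB)/setDP[_]; rewrite xN.
  by rewrite muln1 leq_add.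
Qed.

End DoubleCounting.

(** * Oriented paths under a small independence number *)

Section OrientedPaths.
Variables (T : finType) (D : rel T) (g : nat).
Hypotheses (irrD : irreflexive D)
  (indD : forall I : {set T},
    (forall x y, x \in I -> y \in I -> ~~ adjacent D x y) -> (#|I| <= g)%N).

(** The flag chooses the direction of one edge, so a sequence of flags encodes an arbitrary
    orientation of a path. *)
Definition steered (b : bool) : rel T := if b then D else converse D.

(** Degrees inside [B] are at most those into [A], so [B] contains an independent set of proportion
    [1 / (2 * t).+1]. A digraph and its converse have the same independent sets, so [g] serves both
    directions. *)
Lemma steered_degree b t (A : {set T}) (B := [set x in A | outdeg_in (steered b) x A <= t]%N) :
  (#|B| <= (2 * t).+1 * g)%N.
Proof.
have irrE : irreflexive (steered b) by move=> x; case: b {B}; exact: irrD.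
have [|I [_ indI cB]] := @independent_of_bounded_outdeg _ (steered b) t B irrE.
  move=> x xB; move: (xB); rewrite inE => /andP[_]; apply: leq_trans.
  by apply: outdeg_in_leS; apply/subsetP=> y; rewrite inE => /andP[].
apply: leq_trans cB _; rewrite leq_mul2l /=; apply: indD => x y xI yI.
have := indI x y xI yI; case: b {B irrE indI} => //=.
by rewrite adjacent_converse.
Qed.

(* Discarding the few vertices of small degree first, a path found in the rest
   has an end with a neighbour off the path. *)
Lemma oriented_path_exists (o : nat -> bool) l t (A : {set T}) :
  (t < l)%N -> (t * ((2 * l).+1 * g) < #|A|)%N ->
  exists p : nat -> T,
    [/\ forall j, (j <= t)%N -> p j \in A,
        forall i j, (i <= t)%N -> (j <= t)%N -> p i = p j -> i = j &
        forall j, (j < t)%N -> steered (o j) (p j) (p j.+1)].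
Proof.
elim: t A => [|t IHt] A ltl cA.
  have [x xA] : exists x, x \in A by apply/card_gt0P; apply: leq_ltn_trans cA.
  by exists (fun=> x); split=> // i j; rewrite !leqn0 => /eqP-> /eqP->.
(* The path to be extended has [t.+1 < l] vertices, so more than [l] neighbours of its end leave one
   off the path. *)
pose B := [set x in A | outdeg_in (steered (o t)) x A <= l]%N.
have cB : (#|B| <= (2 * l).+1 * g)%N by apply: steered_degree.
have sBA : B \subset A by apply/subsetP=> x; rewrite inE => /andP[].
have [||p [pA p_inj pE]] := IHt (A :\: B); first exact: ltnW.
  by move: cA; rewrite mulSn -(cardsID B A) (setIidPr sBA); lia.
have degp : (l < outdeg_in (steered (o t)) (p t) A)%N.
  by have /setDP[ptA] := pA t (leqnn t); rewrite inE ptA /= -ltnNge.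
pose P := [set p (val j) | j : 'I_t.+1].
have [y yN yP] : exists2 y, y \in [set y in A | steered (o t) (p t) y] & y \notin P.
  apply/subsetPn; apply: contraL degp => /subset_leq_card.
  rewrite -leqNgt => /leq_trans; apply.
  by apply: leq_trans (leq_imset_card _ _) _; rewrite card_ord ltnW.
have {}yP j : (j <= t)%N -> p j <> y.
  move=> ltj jy; move/negP: yP; apply; rewrite -jy.
  by apply/imsetP; exists (Ordinal (ltj : (j < t.+1)%N)); rewrite ?inE.
move: yN; rewrite inE => /andP[yA pty].
exists (fun j => if (j <= t)%N then p j else y); split.
- by move=> j _; case: ifP => // /pA /setDP[].
- move=> i j lei lej; case: ifP => lit; case: ifP => ljt.
  + exact: p_inj.
  + by move/(yP _ lit).
  + by move/esym/(yP _ ljt).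
  + by move=> _; lia.
- move=> j; rewrite ltnS => ljt; rewrite ljt; case: ltnP => [/pE //|letj].
  by have -> : j = t by apply/eqP; rewrite eqn_leq ljt.
Qed.

End OrientedPaths.

(** * Orientations of a cycle *)

Section CycleOrientations.
Variable (l : nat).

Lemma cycle_orientation_converse (C : rel 'I_l) :
  cycle_orientation C -> cycle_orientation (converse C).
Proof.
move=> [[iC oC] aC]; split; first by split=> // x y; rewrite /converse andbC.
by move=> i j; rewrite adjacent_converse.
Qed.

(** Reversing the labels exchanges successor and predecessor; hence the converse of a directed cycle
    is again one. *)
Lemma rev_ord_ordS (i j : 'I_l) : (rev_ord i == ordS (rev_ord j)) = (j == ordS i).
Proof.
rewrite -!val_eqE /=; case: l i j => [[]//|n] [i /= hi] [j /= hj].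
have [->|j0] := posnP j.
  rewrite subn1 /= modnn; have [->|an] := eqVneq i n; first by rewrite subnn modnn.
  by rewrite modn_small; lia.
rewrite (@modn_small (n.+1 - j.+1).+1); last by lia.
by have [->|an] := eqVneq i n; rewrite ?modnn ?modn_small; lia.
Qed.

Lemma directed_cycle_converse (C : rel 'I_l) :
  directed_cycle (converse C) -> directed_cycle C.
Proof.
case=> s hs; exists (perm (can_inj (@rev_ordK l)) * s)%g => i j.
rewrite !permM !permE -[C _ _]/(converse C (s (rev_ord j)) (s (rev_ord i))) hs.
exact: rev_ord_ordS.
Qed.

Lemma iter_ordS r (i : 'I_l) : iter r (@ordS l) i = ((i + r) %% l)%N :> nat.
Proof.
elim: r => [|r IHr] /=; first by rewrite addn0 modn_small.
by rewrite IHr -addn1 modnDml addn1 addnS.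
Qed.

Lemma iter_ordS_onto (i j : 'I_l) : exists2 r, (r < l)%N & j = iter r (@ordS l) i.
Proof.
have l0 : (0 < l)%N by apply: leq_ltn_trans (ltn_ord i).
exists ((j + (l - i)) %% l)%N; first by rewrite ltn_mod.
apply: val_inj; rewrite /= iter_ordS modnDmr addnCA subnKC; last exact: ltnW.
by rewrite modnDr modn_small.
Qed.

(** A failure at one index passes on to its successor, and successors run through the whole
    cycle. *)
Lemma ordS_constant (c : pred 'I_l) : (forall i, c (ordS i) -> c i) ->
  (forall i, c i) \/ (forall i, ~~ c i).
Proof.
move=> cS; case: (altP (@forallP _ c)) => [|/forallPn[i0 nci]]; first by left.
right=> j; have [r _ ->] := iter_ordS_onto i0 j.
by elim: r => //= r; apply: contra => /cS.
Qed.

Lemma directed_of_ordS (C : rel 'I_l) : cycle_orientation C ->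
  (forall i, C i (ordS i)) -> directed_cycle C.
Proof.
move=> [[_ oC] aC] h; exists 1%g => i j; rewrite !perm1.
apply/idP/eqP => [Cij|->//]; have : adjacent C i j by rewrite /adjacent /= Cij.
by rewrite aC => /orP[/eqP//|/eqP ij]; have := oC i j; rewrite Cij ij h.
Qed.

(** If [ordS i] is never a source, a forward arc out of [ordS i] forces the arc before it to be
    forward too. So all arcs are forward or all are backward, and the cycle is directed. The
    equation [s = ordS i] names the predecessor of [s]. *)
Lemma cycle_source (C : rel 'I_l) : cycle_orientation C -> ~ directed_cycle C ->
  exists2 s, C s (ordS s) & forall i, s = ordS i -> C s i.
Proof.
move=> cC ndC; have [[_ oC] aC] := cC.
have Ci i : C i (ordS i) || C (ordS i) i.
  by have := aC i (ordS i); rewrite eqxx.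
have [|nsrc] := boolP [exists i, C (ordS i) (ordS (ordS i)) && C (ordS i) i].
  move/existsP=> [i /andP[h1 h2]]; exists (ordS i) => // j /ordS_inj <- //.
exfalso; apply: ndC.
have [i|h|h] := @ordS_constant (fun i => C i (ordS i)).
- move=> h; have := existsPn nsrc i; rewrite h /=.
  by have := Ci i; case: (C (ordS i) i) => //; rewrite orbF.
- exact: directed_of_ordS.
- apply: directed_cycle_converse; apply: directed_of_ordS.
    exact: cycle_orientation_converse.
  by move=> i; have := Ci i; rewrite (negPf (h i)).
Qed.

End CycleOrientations.

(** * Copies of the cycle through a given vertex *)

(** Deleting a source from the cycle leaves an oriented path, which exists inside [A]. Since [v]
    dominates [A], it can play the source whatever the ends of the path are. *)
Lemma copy_at_source (l : nat) (C : rel 'I_l) (T : finType) (D : rel T) (g : nat)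
    (v : T) (A : {set T}) :
  (3 <= l)%N -> cycle_orientation C -> ~ directed_cycle C -> irreflexive D ->
  (forall I : {set T},
    (forall x y, x \in I -> y \in I -> ~~ adjacent D x y) -> (#|I| <= g)%N) ->
  (forall x, x \in A -> D v x) -> (l * ((2 * l).+1 * g) < #|A|)%N ->
  exists2 phi : {ffun 'I_l -> T}, copy C D phi &
    v \in copy_vertices phi /\ copy_vertices phi \subset v |: A.
Proof.
case: l C => [|[|l]] C // l3 cC ndC iD indD vA cA.
have [s Cs sC] := cycle_source cC ndC; have [[_ oC] aC] := cC.
(* [u] walks around the cycle starting at the source [s]. *)
pose u r := iter r (@ordS l.+2) s.
have u_onto j : exists2 r, (r < l.+2)%N & j = u r by exact: iter_ordS_onto.
have u_inj r r' : (r < l.+2)%N -> (r' < l.+2)%N -> u r = u r' -> r = r'.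
  move=> hr hr' /(congr1 (@nat_of_ord _)); rewrite !iter_ordS => /eqP.
  by rewrite eqn_modDl !modn_small // => /eqP.
have ul : u l.+2 = u 0%N by apply: ord_inj; rewrite iter_ordS modnDr modn_small.
(* The path vertex [p j] will sit at [u j.+1], hence the shift in the flags. *)
have [||p [pA p_inj pE]] :=
    @oriented_path_exists _ _ g iD indD (fun r => C (u r.+1) (u r.+2)) l.+2 l A => //.
  by apply: leq_ltn_trans cA; rewrite leq_mul2r; apply/orP; right; lia.
(* [k] inverts [u]: it is the position of [i] counted from [s]. *)
pose k (i : 'I_l.+2) := ((i + (l.+2 - s)) %% l.+2)%N.
have kP r : (r < l.+2)%N -> k (u r) = r.
  move=> hr; rewrite /k iter_ordS modnDml addnAC subnKC; last exact: ltnW.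
  by rewrite modnDl modn_small.
pose h r := if r is j.+1 then p j else v.
have vNA : v \notin A by apply/negP=> /vA; rewrite iD.
pose phi := [ffun i => h (k i)].
have phiE r : (r < l.+2)%N -> phi (u r) = h r by move=> hr; rewrite ffunE kP.
have h_inj r r' : (r < l.+2)%N -> (r' < l.+2)%N -> h r = h r' -> r = r'.
  case: r r' => [|r] [|r'] //=; rewrite ?ltnS => hr hr' e.
  - by move: vNA; rewrite e pA.
  - by move: vNA; rewrite -e pA.
  - by rewrite (p_inj _ _ hr hr' e).
exists phi; first split.
- move=> i j; have [r hr ->] := u_onto i; have [r' hr' ->] := u_onto j.
  by rewrite !phiE // => /h_inj ->.
(* Forward arcs: the closing arc [r = l.+1] would enter the source, which is impossible. For
   backward arcs, in [pets], it is [r = 0] that is impossible, and the closing arc leaves [v]. *)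
- have step r : (r < l.+2)%N -> C (u r) (u r.+1) -> D (h r) (phi (u r.+1)).
    rewrite ltnS leq_eqVlt => /orP[/eqP->|hr] Cr.
      by have := oC (u l.+1) (u l.+2); rewrite Cr ul sC // -[LHS]ul.
    rewrite phiE //; case: r hr Cr => [|r] hr Cr /=; first exact: vA (pA _ _).
    by have := pE r hr; rewrite Cr.
  have pets r : (r < l.+2)%N -> C (u r.+1) (u r) -> D (phi (u r.+1)) (h r).
    rewrite ltnS leq_eqVlt => /orP[/eqP->|hr] Cr.
      by rewrite ul (phiE 0%N) //; exact: vA (pA _ _).
    rewrite phiE //; case: r hr Cr => [|r] hr Cr /=.
      by have := oC s (ordS s); rewrite Cs /= -[C _ _]/(C (u 1%N) (u 0%N)) Cr.
    have := pE r hr; rewrite /steered; case Cr': (C (u r.+1) (u r.+2)) => //.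
    by have := oC (u r.+1) (u r.+2); rewrite Cr Cr'.
  move=> i j Cij; have : adjacent C i j by rewrite /adjacent /= Cij.
  rewrite aC => /orP[]/eqP e.
    move: Cij; rewrite e; have [r hr ->] := u_onto i.
    by rewrite (phiE r) // => /(step _ hr).
  move: Cij; rewrite e; have [r hr ->] := u_onto j.
  by rewrite (phiE r) // => /(pets _ hr).
- split; first by apply/imsetP; exists (u 0%N); rewrite ?inE ?phiE.
  apply/subsetP=> x /imsetP[i _ ->]; have [r hr ->] := u_onto i.
  rewrite phiE // in_setU1; case: r hr => [|r] hr /=; first by rewrite eqxx.
  by rewrite pA ?orbT.
Qed.

(** If the in-degree of [v] is the larger one, [C] and [D] are both replaced by their converses, so
    that [v] becomes a sink of the copy. The vertex [v] itself may belong to the forbidden set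
    [X]. *)
Lemma copy_through (l : nat) (C : rel 'I_l) (T : finType) (D : rel T) (g : nat)
    (v : T) (X : {set T}) :
  (3 <= l)%N -> cycle_orientation C -> ~ directed_cycle C -> irreflexive D ->
  (forall I : {set T},
    (forall x y, x \in I -> y \in I -> ~~ adjacent D x y) -> (#|I| <= g)%N) ->
  (l * ((2 * l).+1 * g) + #|X| < dstar D v)%N ->
  exists2 phi : {ffun 'I_l -> T}, copy C D phi &
    v \in copy_vertices phi /\ copy_vertices phi \subset v |: ~: X.
Proof.
move=> l3 cC ndC iD indD.
have cD (N : {set T}) : (#|N| <= #|N :\: X| + #|X|)%N.
  by rewrite -(cardsID X N) addnC leq_add2l subset_leq_card ?subsetIr.
have [oi|io] := leqP (indeg D v) (outdeg D v).
  rewrite /dstar (maxn_idPl oi) => dX.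
  have [||phi cphi [vphi sphi]] := @copy_at_source l C T D g v
      ([set y in setT | D v y] :\: X) l3 cC ndC iD indD.
  - by move=> x; rewrite !inE => /andP[].
  - by rewrite -(ltn_add2r #|X|); apply: leq_trans dX (cD _).
  by exists phi => //; split=> //; apply: subset_trans sphi _; rewrite setUS // subsetDr.
rewrite /dstar (maxn_idPr (ltnW io)) => dX.
have [|||||phi [phi_inj phiD] [vphi sphi]] := @copy_at_source l (converse C) T (converse D) g v
    ([set y in setT | D y v] :\: X) l3 (cycle_orientation_converse cC).
- by move=> /directed_cycle_converse.
- by move=> x; exact: iD.
- move=> I indI; apply: indD => x y xI yI; rewrite -adjacent_converse; exact: indI.
- by move=> x; rewrite !inE => /andP[].
- by rewrite -(ltn_add2r #|X|); apply: leq_trans dX (cD _).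
exists phi; first by split=> // i j Cij; apply: (phiD j i).
by split=> //; apply: subset_trans sphi _; rewrite setUS // subsetDr.
Qed.

(** * A linear lower bound for [dstar] *)

Section DegreeLowerBound.
Variables (R : realType) (T : finType) (D : rel T) (mu : R).
Hypotheses (oD : oriented_graph D) (mu_le : mu <= 1 / 4)
  (oreD : (((3 / 4 + mu) * #|T|%:R)%:E <= sigma_Ore D R)%E).

Lemma ore_pair x y : x != y -> ~~ adjacent D x y ->
  (3 / 4 + mu) * #|T|%:R <= (dstar D x + dstar D y)%:R.
Proof.
move=> xy nxy; rewrite -lee_fin; apply: le_trans oreD _.
apply: (@bigmin_le_cond _ _ _ _ (x, y) _
  (fun p : T * T => ((dstar D p.1 + dstar D p.2)%:R)%:E)).
by rewrite /= xy.
Qed.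

(* Apart from [v] and its few neighbours, [S], every vertex has a large
   in- or out-degree; counting the arcs that leave the vertices of one kind
   shows that this fits into an oriented graph only if [S] is large. *)
Lemma dstar_lower_bound v : 1 <= mu * #|T|%:R -> mu * #|T|%:R <= 2 * (dstar D v)%:R.
Proof.
move=> n1; set n := #|T| in n1 *; set de := dstar D v.
pose S := v |: ([set y in setT | D v y] :|: [set y in setT | D y v]).
have cS : (#|S| <= (2 * de).+1)%N.
  rewrite mul2n -addnn -add1n; apply: leq_trans (leq_card_setU _ _) _.
  rewrite cards1 leq_add2l; apply: leq_trans (leq_card_setU _ _) _.
  by rewrite leq_add ?leq_maxl ?leq_maxr.
(* What the Ore condition leaves for a non-neighbour of [v]. *)
pose K : R := (3 / 4 + mu) * n%:R - de%:R.
have KP u : u \notin S -> K <= (dstar D u)%:R.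
  rewrite !inE /= !negb_or => /and3P[uv vu uv'].
  have := @ore_pair v u; rewrite natrD -/n -/de /K eq_sym => /(_ uv).
  by rewrite /adjacent /= (negPf vu) (negPf uv') => /(_ isT); lra.
pose A := Pplus D :\: S; pose B := Pminus D :\: S.
have cAB : (#|A| + #|B| + #|S| = n)%N.
  rewrite /n -(cardsC S) addnC; congr (_ + _)%N.
  rewrite -(cardsID (Pplus D) (~: S)) /A /B; congr (_ + _)%N.
    by apply: eq_card => x; rewrite !inE andbC.
  by apply: eq_card => x; rewrite !inE andbC.
have coverT : setT = A :|: B :|: S.
  rewrite /A /B /Pminus; apply/setP=> x; move: (Pplus D) {A B K KP cAB cS}S => P S'.
  by rewrite !inE; case: (x \in S'); case: (x \in P).
(* At most [#|X|^2 / 2] arcs stay inside [X] and at most [#|X| * (#|Y| + #|S|)] leave it; dividing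
   by [#|X|] gives the bound. The relation [E] is general so that the converse of [D] can handle
   [B]. *)
have half (E : rel T) (X Y : {set T}) : oriented_graph E ->
  setT = X :|: Y :|: S -> (forall x, x \in X -> K <= (outdeg E x)%:R) ->
  (0 < #|X|)%N -> 2 * K <= #|X|%:R + 2 * #|Y|%:R + 2 * #|S|%:R.
  move=> oE cT KX X0.
  have degE x : (outdeg E x <= outdeg_in E x X + (#|Y| + #|S|))%N.
    rewrite /outdeg cT -setUA; apply: leq_trans (outdeg_inU _ _ _ _) _.
    rewrite leq_add2l; apply: leq_trans (outdeg_in_le _ _ _) _.
    exact: leq_card_setU.
  have h1 : K * #|X|%:R <= (\sum_(x in X) outdeg_in E x X)%:R + #|X|%:R * (#|Y| + #|S|)%:R.
    apply: (@le_trans _ _ (\sum_(x in X) (outdeg E x)%:R)).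
      by rewrite mulr_natr -sumr_const; exact: ler_sum.
    rewrite -natr_sum -natrM -natrD ler_nat -sum_nat_const -big_split.
    by apply: leq_sum => x _; exact: degE.
  have h2 := sum_outdeg_in_self X oE.
  rewrite -(ler_nat R) !natrM in h2; rewrite natrD in h1.
  by rewrite -(ler_pM2r (_ : 0 < #|X|%:R)) ?ltr0n //; nra.
have hA : (0 < #|A|)%N -> 2 * K <= #|A|%:R + 2 * #|B|%:R + 2 * #|S|%:R.
  apply: (half D) => // x /setDP[xP /KP]; move: xP; rewrite inE => io.
  by rewrite /dstar (maxn_idPl io).
have hB : (0 < #|B|)%N -> 2 * K <= #|B|%:R + 2 * #|A|%:R + 2 * #|S|%:R.
  apply: (half (converse D)).
  - by case: oD => iD aD; split=> // x y; rewrite /converse andbC.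
  - by rewrite coverT (setUC A).
  - move=> x /setDP[xP /KP]; move: xP; rewrite !inE -ltnNge => io.
    by rewrite /dstar (maxn_idPr (ltnW io)).
have cABR : #|A|%:R + #|B|%:R + #|S|%:R = n%:R :> R by rewrite -cAB !natrD.
have cSR : #|S|%:R <= 2 * de%:R + 1 :> R by rewrite -natrM natr1 ler_nat.
have dn0 : 0 <= n%:R :> R by [].
have hmu : mu * n%:R <= 1 / 4 * n%:R by rewrite ler_wpM2r.
rewrite /K in hA hB.
(* If both sets are nonempty, the sum of [hA] and [hB] is [4 * K <= 3 * n + #|S|]. Here the constant
   [3 / 4] cancels, leaving [4 * mu * n <= 6 * de + 1]. *)
have [A0|A0] := posnP #|A|; have [B0|B0] := posnP #|B|.
- by move: cABR; rewrite A0 B0; lra.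
- by move: cABR (hB B0); rewrite A0; lra.
- by move: cABR (hA A0); rewrite B0; lra.
- by move: (hA A0) (hB B0); lra.
Qed.

End DegreeLowerBound.

(** * Cardinalities of unions and of disjoint families *)

Section DisjointFamilies.
Variables (T I : finType) (W : I -> {set T}).

Lemma card_bigcup_le (P : pred I) :
  (#|\bigcup_(i | P i) W i| <= \sum_(i | P i) #|W i|)%N.
Proof.
elim/big_rec2: _ => [|i n A _ h]; first by rewrite cards0.
by apply: leq_trans (leq_card_setU _ _) _; rewrite leq_add2l.
Qed.

Lemma sum_card_disjoint (P : pred I) (X : {set T}) :
  (forall i j, i != j -> [disjoint W i & W j]) ->
  (\sum_(i | P i) #|X :&: W i| <= #|X|)%N.
Proof.
move=> dW.
have cardW i : #|X :&: W i| = (\sum_(x in X) (x \in W i))%N.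
  rewrite -sum1_card (eq_bigl (fun x => (x \in X) && (x \in W i))).
    by rewrite big_mkcondr; apply: eq_bigr => x _; case: (x \in W i).
  by move=> x; rewrite inE.
under eq_bigr do rewrite cardW.
rewrite exchange_big -sum1_card /=; apply: leq_sum => x xX.
have [/exists_inP[i Pi xi]|/exists_inPn xW] := boolP [exists (i | P i), x \in W i].
  rewrite (bigD1 i) //= xi big1 // => j /andP[_ ji].
  by have := disjointFl (dW _ _ ji) xi => ->.
by rewrite big1 // => i /xW; case: (x \in W i).
Qed.

End DisjointFamilies.

(** * Vertices of low degree in regular pairs *)

Section Regularity.
Variables (R : realType) (T : finType).
Implicit Types (D : rel T) (X Y B : {set T}).

Lemma card_arcs D X Y :
  #|[set p in setX X Y | D p.1 p.2]| = (\sum_(x in X) outdeg_in D x Y)%N.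
Proof.
under eq_bigr do rewrite outdeg_inE.
rewrite pair_big -sum1_card /= [RHS]big_mkcond /= [LHS]big_mkcond /=.
apply: eq_bigr => -[x y] _; rewrite !inE /=.
by case: (x \in X); case: (y \in Y); case: (D x y).
Qed.

Lemma density_converse D X Y : density (converse D) R X Y = density D R Y X.
Proof.
rewrite /density !card_arcs double_count [X in _ / X]mulrC; congr (_%:R / _).
Qed.

Lemma eps_regular_converse D (eps : R) X Y :
  eps_regular D eps X Y -> eps_regular (converse D) eps Y X.
Proof.
move=> reg Y' X' sY sX hY hX; rewrite (density_converse D Y') (density_converse D Y); exact: reg.
Qed.

(** A larger [B] would be an admissible test set against the whole of [Y], but its low degrees push
    the density of [(B, Y)] down by at least [eps]. *)
Lemma card_low_outdeg D (eps : R) X Y B :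
  0 < eps -> eps <= 1 -> eps_regular D eps X Y -> B \subset X ->
  (forall x, x \in B -> (outdeg_in D x Y)%:R < (density D R X Y - eps) * #|Y|%:R) ->
  #|B|%:R <= eps * #|X|%:R.
Proof.
move=> eps0 eps1 reg sBX degB; rewrite leNgt; apply/negP=> ltB.
have B0 : (0 < #|B|)%N.
  by rewrite -(ltr0n R); apply: le_lt_trans ltB; rewrite mulr_ge0 // ltW.
have Y0 : (0 < #|Y|)%N.
  have [x /degB] := card_gt0P B0; case: posnP => // ->.
  by rewrite mulr0 ltrn0.
have := reg B Y sBX (subxx _) (ltW ltB); rewrite ler_piMl // => /(_ isT).
rewrite ltr_norml => /andP[+ _]; apply/negP; rewrite -leNgt.
rewrite lerBlDr {1}/density card_arcs ler_pdivrMr ?mulr_gt0 ?ltr0n //.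
rewrite natr_sum [#|B|%:R * _]mulrC mulrA mulr_natr -sumr_const.
by apply: ler_sum => x xB; apply: ltW; rewrite addrC; exact: degB.
Qed.

End Regularity.

(** * Sizes of the bad set and of the clusters *)

Section BadSet.
Variables (R : realType) (T : finType) (D D' : rel T) (eps d : R).
Variables (M0 M k m : nat) (V0 : {set T}) (V : 'I_k -> {set T}) (f : 'I_k -> 'I_k).
Hypotheses (eps_gt0 : 0 < eps) (eps_le1 : eps <= 1)
  (rp : regularity_partition D D' eps d M0 M m V0 V) (pf : partner_map D D' d V f).

Let E := bad_set D D' eps m V0 V f.

Lemma card_bad_in i : #|bad_in D D' eps m V f i|%:R <= eps * m%:R.
Proof.
have [fi _ _] := pf i.
have sB : bad_in D D' eps m V f i \subset V i.
  by apply/subsetP=> x; rewrite inE => /andP[].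
rewrite -{2}(rp_size rp i).
have [sP|sP] := boolP (V i \subset Pplus D).
  have ifi : i != f i by rewrite eq_sym.
  apply: (card_low_outdeg eps_gt0 eps_le1 (rp_regular rp ifi) sB).
  move=> x; rewrite inE sP /= => /andP[xV].
  case/orP=> [|/andP[sM]]; first by rewrite (rp_size rp).
  by have := subsetP sM x xV; rewrite inE (subsetP sP x xV).
(* For a cluster in [Pminus], low in-degrees are low out-degrees in the converse. *)
apply: (card_low_outdeg eps_gt0 eps_le1 (eps_regular_converse (rp_regular rp fi)) sB).
move=> x; rewrite inE (negPf sP) /= => /and3P[_ _].
by rewrite (density_converse _ D') (rp_size rp).
Qed.

Lemma bad_set_cluster i : E :&: V i \subset bad_in D D' eps m V f i.
Proof.
apply/subsetP=> x /setIP[/setUP[xV0|/bigcupP[j _ xj]] xV].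
  by have := rp_disjoint0 rp i; rewrite disjoint_subset => /subsetP/(_ x xV0); rewrite inE xV.
have [<- //|ji] := eqVneq j i.
have := rp_disjoint rp ji; rewrite disjoint_subset => /subsetP/(_ x); rewrite inE xV.
by move: xj; rewrite inE => /andP[-> _] /(_ isT).
Qed.

Lemma clusters_le : (k * m <= #|T|)%N.
Proof.
have -> : (k * m = \sum_i #|setT :&: V i|)%N.
  by under eq_bigr do rewrite setTI (rp_size rp); rewrite sum_nat_const card_ord.
by rewrite -cardsT; apply: sum_card_disjoint (rp_disjoint rp).
Qed.

Lemma clusters_ge : (#|T| <= #|V0| + k * m)%N.
Proof.
rewrite -cardsT -(rp_cover rp); apply: leq_trans (leq_card_setU _ _) _.
rewrite leq_add2l; apply: leq_trans (card_bigcup_le _ _) _.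
by under eq_bigr do rewrite (rp_size rp); rewrite sum_nat_const card_ord.
Qed.

Lemma card_bad_set : #|E|%:R <= 2 * eps * #|T|%:R.
Proof.
have h : (#|E| <= #|V0| + \sum_i #|bad_in D D' eps m V f i|)%N.
  by apply: leq_trans (leq_card_setU _ _) _; rewrite leq_add2l card_bigcup_le.
have h2 : (\sum_i #|bad_in D D' eps m V f i|)%:R <= eps * #|T|%:R.
  rewrite natr_sum; apply: (@le_trans _ _ (\sum_(i < k) eps * m%:R)).
    by apply: ler_sum => i _; exact: card_bad_in.
  rewrite sumr_const card_ord -[leLHS]mulr_natr -mulrA -natrM ler_pM2l // ler_nat mulnC.
  exact: clusters_le.
move: h; rewrite -(ler_nat R) natrD => h; have := rp_exceptional rp; lra.
Qed.

End BadSet.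

(** * Greedy construction of the tiling *)

Lemma card_copy_vertices l (T : finType) (C : rel 'I_l) (D : rel T) phi :
  copy C D phi -> #|copy_vertices phi| = l.
Proof. by case=> phi_inj _; rewrite card_imset // card_ord. Qed.

Lemma tiling_verticesU1 l (T : finType) (phi : {ffun 'I_l -> T}) F :
  tiling_vertices (phi |: F) = copy_vertices phi :|: tiling_vertices F.
Proof. by rewrite /tiling_vertices bigcup_setU big_set1. Qed.

(* A cluster that has received more than [c] good vertices is not used again. *)
Lemma greedy_tiling l (T : finType) (C : rel 'I_l) (D : rel T) (E : {set T})
    k (V : 'I_k -> {set T}) (m c N : nat) :
  (forall i j, i != j -> [disjoint V i & V j]) -> (forall i, #|V i| = m) ->
  (forall j, (j * c.+1 <= l * #|E|)%N -> (#|E| + l * #|E| + j * m <= N)%N) ->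
  (forall v (X : {set T}), v \in E -> (#|X| <= N)%N ->
    exists2 phi : {ffun 'I_l -> T}, copy C D phi &
      v \in copy_vertices phi /\ copy_vertices phi \subset v |: ~: X) ->
  exists F : {set {ffun 'I_l -> T}},
    [/\ tiling C D F,
        (forall phi, phi \in F -> #|copy_vertices phi :&: E| = 1%N),
        E \subset tiling_vertices F,
        #|tiling_vertices F| = (l * #|E|)%N &
        forall i, (#|(tiling_vertices F :&: V i) :\: E| <= c + l)%N].
Proof.
move=> dV cV hN hcopy.
(* Covering [E] is restated as a count, which also makes sense for a partial tiling and allows
   induction on the number of covered bad vertices. *)
suff [F [tF F1 cE cF VF]]: exists F : {set {ffun 'I_l -> T}},
    [/\ tiling C D F,
        (forall phi, phi \in F -> #|copy_vertices phi :&: E| = 1%N),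
        #|tiling_vertices F :&: E| = #|E|,
        #|tiling_vertices F| = (l * #|E|)%N &
        forall i, (#|(tiling_vertices F :&: V i) :\: E| <= c + l)%N].
  exists F; split=> //; apply/setIidPr/eqP.
  by rewrite eqEcard subsetIr cE leqnn.
elim: {-2}#|E| (leqnn #|E|) => [_|q IHq ltq].
  have tv0 : tiling_vertices set0 = set0 :> {set T} by move=> n; rewrite /tiling_vertices big_set0.
  exists set0; split=> [|phi||| i]; rewrite ?inE ?tv0 ?set0I ?set0D ?cards0 ?muln0 //.
  by split=> phi; rewrite inE.
have [F [[tF1 tF2] F1 cE cF VF]] := IHq (ltnW ltq).
have [v vE vF] : exists2 v, v \in E & v \notin tiling_vertices F.
  apply/subsetPn/negP=> /setIidPr EF; move: cE; rewrite EF => cE.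
  by move: ltq; rewrite cE ltnn.
pose J := [pred i | (c < #|(tiling_vertices F :&: V i) :\: E|)%N].
(* Avoiding [E] keeps [v] the only bad vertex of the new copy; the other two sets give disjointness
   and spare the full clusters [J]. *)
pose X := E :|: tiling_vertices F :|: \bigcup_(i | J i) V i.
have cX : (#|X| <= N)%N.
  (* Each full cluster holds at least [c.+1] of the at most [l * #|E|] vertices covered so far. *)
  have cJ : (#|J| * c.+1 <= l * #|E|)%N.
    rewrite -sum_nat_const; apply: (@leq_trans #|tiling_vertices F|).
      apply: leq_trans (sum_card_disjoint J _ dV); apply: leq_sum => i iJ.
      by apply: leq_trans iJ _; rewrite subset_leq_card ?subsetDl.
    by rewrite cF leq_mul2l (ltnW ltq) orbT.
  apply: leq_trans (hN _ cJ); apply: leq_trans (leq_card_setU _ _) _.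
  apply: leq_add.
    by apply: leq_trans (leq_card_setU _ _) _; rewrite leq_add2l cF leq_mul2l (ltnW ltq) orbT.
  apply: leq_trans (card_bigcup_le _ _) _.
  by under eq_bigr do rewrite cV; rewrite sum_nat_const.
have [phi cphi [vphi sphi]] := hcopy v X vE cX.
have phiX x : x \in copy_vertices phi -> x != v -> x \notin X.
  by move=> /(subsetP sphi); rewrite in_setU1 in_setC => /orP[->|].
have phiF : [disjoint copy_vertices phi & tiling_vertices F].
  rewrite disjoint_subset; apply/subsetP=> x xphi; rewrite inE.
  have [->//|/(phiX _ xphi)] := eqVneq x v.
  by apply: contra => xF; rewrite !in_setU xF orbT.
have phiE : copy_vertices phi :&: E = [set v].
  apply/setP=> x; rewrite !inE; have [->|/phiX xX] := eqVneq x v; first by rewrite vphi.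
  apply/negP=> /andP[/xX/negP nX xE]; apply: nX.
  by rewrite !in_setU xE.
have sF psi : psi \in F -> copy_vertices psi \subset tiling_vertices F.
  by move=> psiF; apply: bigcup_sup.
have cardU (A B : {set T}) : [disjoint A & B] -> #|A :|: B| = (#|A| + #|B|)%N.
  by rewrite -leq_card_setU => /eqP.
exists (phi |: F); rewrite tiling_verticesU1; split.
- split=> [psi /setU1P[->//|]|psi psi' /setU1P[->|pF] /setU1P[->|pF']].
  + exact: tF1.
  + by rewrite eqxx.
  + by move=> _; apply: disjointWr phiF; exact: sF.
  + by move=> _; rewrite disjoint_sym; apply: disjointWr phiF; exact: sF.
  + exact: tF2.
- by move=> psi /setU1P[->|/F1//]; rewrite phiE cards1.
- rewrite setIUl cardU ?phiE ?cards1 ?cE //.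
  by rewrite disjoints1 inE negb_and vF.
- by rewrite cardU // cF (card_copy_vertices cphi) mulnS.
- move=> i; rewrite setIUl setDUl.
  have [iJ|iJ] := boolP (J i).
    have -> : (copy_vertices phi :&: V i) :\: E = set0.
      apply/setP=> x; rewrite !inE; apply/negP=> /and3P[xE xphi xV].
      have xv : x != v by apply: contraNneq xE => ->.
      have xX : x \in X by apply/setUP; right; apply/bigcupP; exists i.
      by have := phiX x xphi xv; rewrite xX.
    by rewrite set0U.
  apply: leq_trans (leq_card_setU _ _) _; rewrite addnC leq_add //; first by rewrite leqNgt.
  apply: leq_trans (subset_leq_card _) (eq_leq (card_copy_vertices cphi)).
  by apply: subset_trans (subsetDl _ _) (subsetIl _ _).
Qed.

(** * Choice of constants and assembly *)

Theorem lemma3p1 (R : realType) :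
  forall mu : R, 0 < mu -> mu <= 10 ^- 2 ->
  exists2 d0 : R, 0 < d0 & forall d : R, 0 < d -> d <= d0 ->
  forall l : nat, (3 <= l)%N ->
  exists2 eps0 : R, 0 < eps0 & forall eps : R, 0 < eps -> eps <= eps0 ->
  forall M : nat,
  exists2 gamma0 : R, 0 < gamma0 &
    forall gamma : R, 0 < gamma -> gamma <= gamma0 ->
  forall M0 : nat, (3 < M0)%N -> (M0 <= M)%N ->
  exists n0 : nat,
  forall C : rel 'I_l, cycle_orientation C -> ~ directed_cycle C ->
  forall (T : finType) (D : rel T),
    oriented_graph D ->
    (n0 <= #|T|)%N ->
    (((3 / 4 + mu) * #|T|%:R)%:E <= sigma_Ore D R)%E ->
    (independence_number D)%:R <= gamma * #|T|%:R ->
  forall (D' : rel T) (k m : nat) (V0 : {set T}) (V : 'I_k -> {set T}),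
    regularity_partition D D' eps d M0 M m V0 V ->
  forall f : 'I_k -> 'I_k,
    partner_map D D' d V f ->
  let E := bad_set D D' eps m V0 V f in
  exists F : {set {ffun 'I_l -> T}},
    [/\ tiling C D F,
        (forall phi, phi \in F -> #|copy_vertices phi :&: E| = 1%N)
          /\ E \subset tiling_vertices F,
        [/\ #|tiling_vertices F| = (l * #|E|)%N,
            (l * #|E|)%:R <= 2 * l%:R * eps * #|T|%:R &
            2 * l%:R * eps * #|T|%:R <= Num.sqrt eps * #|T|%:R] &
        forall i : 'I_k,
          #|tiling_vertices F :&: V i|%:R <= 3 * Num.sqrt eps * m%:R].
Proof.
move=> mu mu0 mule; exists 1 => // d _ _ l l3.
have l0 : 0 < l%:R :> R by rewrite ltr0n; lia.
(* The bound [eps <= q ^+ 2] amounts to [100 * l * sqrt eps <= mu]. *)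
pose q : R := mu / (100 * l%:R).
have q0 : 0 < q by rewrite divr_gt0 ?mulr_gt0.
exists (q ^+ 2); first by rewrite exprn_gt0.
move=> eps eps0 epsq M; pose r : R := Num.sqrt eps.
have r0 : 0 < r by rewrite sqrtr_gt0.
have epsE : eps = r ^+ 2 by rewrite sqr_sqrtr ?ltW.
have rq : r <= q by move: epsq; rewrite epsE ler_pXn2r // nnegrE ltW.
have rl : 100 * l%:R * r <= mu by rewrite mulrC -ler_pdivlMr ?mulr_gt0.
have mu1 : mu <= 1 / 100 by apply: le_trans mule _; lra.
have lge1 : 1 <= l%:R :> R by rewrite ler1n; lia.
have rlr : r <= l%:R * r by rewrite ler_peMl // ltW.
have r1 : r <= 1 / 10000 by lra.
have eps_r : eps <= r by rewrite epsE expr2 ler_piMl ?ltW //; lra.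
have eps1 : eps <= 1 by lra.
pose L : R := l%:R * (2 * l).+1%:R.
have L0 : 0 < L by rewrite mulr_gt0.
(* [L * g] is the room [copy_through] needs for a path; this [gamma0] keeps it below
   [mu * n / 8]. *)
exists (mu / (8 * L)); first by rewrite divr_gt0 ?mulr_gt0.
move=> gamma gamma0 gammaL M0 M03 M0M.
(* The first summand yields [l <= r * m], the second [1 <= mu * n]. *)
exists (Num.bound (2 * M%:R * l%:R / r) + Num.bound (mu^-1))%N.
move=> C cC ndC T D oD nT oreD alD D' k m V0 V rp f pf E.
set n : R := #|T|%:R.
have n1 : 1 <= mu * n.
  have h : mu^-1 < (Num.bound (mu^-1))%:R by apply: archi_boundP; rewrite invr_ge0 ltW.
  rewrite mulrC -ler_pdivrMr // div1r; apply: le_trans (ltW h) _.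
  by rewrite /n ler_nat (leq_trans _ nT) // leq_addl.
have n0 : 0 < n by rewrite -(pmulr_rgt0 _ mu0); lra.
have nM : 2 * M%:R * l%:R <= r * n.
  rewrite [r * n]mulrC -ler_pdivrMr //; apply: le_trans (ltW (archi_boundP _)) _.
    by rewrite divr_ge0 ?mulr_ge0 // ltW.
  by rewrite /n ler_nat (leq_trans _ nT) // leq_addr.
have cE : #|E|%:R <= 2 * eps * n := card_bad_set eps0 eps1 rp pf.
(* A cluster has at least [n / (2 * M)] vertices, so a whole copy costs it at most [r * m]. *)
have lrm : l%:R <= r * m%:R.
  have := clusters_ge rp; have := rp_exceptional rp; rewrite -/n -(ler_nat R) natrD natrM -/n => h1 h2.
  have kM : k%:R <= M%:R :> R by rewrite ler_nat; case/andP: (rp_number rp).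
  have M_gt0 : 0 < M%:R :> R by rewrite ltr0n (leq_trans _ M0M) // ltnW // ltnW // ltnW.
  have h3 : k%:R * m%:R <= M%:R * m%:R :> R by rewrite ler_wpM2r.
  have h4 : eps * n <= 1 / 2 * n by rewrite ler_pM2r //; clear -eps_r r1; lra.
  have h5 : r * n <= r * (2 * (M%:R * m%:R)) by rewrite ler_pM2l //; clear -h1 h2 h3 h4; lra.
  by rewrite -(ler_pM2l M_gt0); clear -nM h5; lra.
pose c := Num.trunc (r * m%:R).
have cle : c%:R <= r * m%:R by rewrite truncn_le // mulr_ge0 // ltW.
have clt : r * m%:R < c.+1%:R by rewrite -truncn_lt_nat // mulr_ge0 // ltW.
pose g := independence_number D.
have indD (I : {set T}) : (forall x y, x \in I -> y \in I -> ~~ adjacent D x y) -> (#|I| <= g)%N.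
  move=> indI; apply: (@leq_bigmax_cond _ _ (fun A : {set T} => #|A|)).
  by apply/forall_inP=> x xI; apply/forall_inP=> y; exact: indI.
(* The budget of forbidden vertices: [dstar] is at least [mu * n / 2], so [mu * n / 4] neighbours
   remain, more than [L * g]. *)
pose N := Num.trunc (mu * n / 4).
have Nle : N%:R <= mu * n / 4 by rewrite truncn_le // divr_ge0 // mulr_ge0 // ltW.
have gL : L * g%:R <= mu * n / 8.
  apply: (@le_trans _ _ (L * (mu / (8 * L) * n))).
    by rewrite ler_pM2l // (le_trans alD) // ler_pM2r.
  by rewrite le_eqVlt; apply/orP; left; apply/eqP; field; rewrite lt0r_neq0.
have [|v X vE XN|F [tF F1 EF cF VF]] :=
    @greedy_tiling l T C D E k V m c N (rp_disjoint rp) (rp_size rp).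
(* With [y = l * r * n], each of the three terms is at most [2 * y], and [6 * y] is well below
   [mu * n / 4]. *)
- move=> j; rewrite -(ler_nat R) !natrM => hj; rewrite truncn_ge_nat; last first.
    by rewrite divr_ge0 // mulr_ge0 // ltW.
  have h1 : j%:R * (r * m%:R) <= l%:R * (2 * r ^+ 2 * n).
    apply: (@le_trans _ _ (j%:R * c.+1%:R)); first by rewrite ler_wpM2l // ltW.
    by apply: le_trans hj _; rewrite ler_wpM2l // -epsE.
  have h2 : j%:R * m%:R <= 2 * l%:R * r * n.
    rewrite -(ler_pM2l r0) mulrCA; apply: le_trans h1 _.
    by have -> : l%:R * (2 * r ^+ 2 * n) = r * (2 * l%:R * r * n) by ring.
  pose y := l%:R * r * n.
  have y100 : 100 * y <= mu * n by rewrite /y !mulrA ler_wpM2r // ltW.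
  have rn0 : 0 < r * n by rewrite mulr_gt0.
  have hE : #|E|%:R <= 2 * y.
    apply: le_trans cE _; rewrite /y -mulrA ler_pM2l // ler_pM2r //.
    exact: le_trans eps_r rlr.
  have hlE : l%:R * #|E|%:R <= 2 * y.
    apply: (@le_trans _ _ (l%:R * (2 * eps * n))); first by rewrite ler_wpM2l // ltW.
    have -> : l%:R * (2 * eps * n) = 2 * y * r by rewrite epsE /y; ring.
    by rewrite ler_piMr ?mulr_ge0 // ?ltW //; clear -r1; lra.
  have h3 : j%:R * m%:R <= 2 * y by rewrite /y !mulrA.
  by rewrite !natrD !natrM; clear -y100 hE hlE h3 rn0 n1; lra.
- apply: (@copy_through _ _ _ _ g) => //; first by case: oD.
  have XNR : #|X|%:R <= N%:R :> R by rewrite ler_nat.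
  have mu4 : mu <= 1 / 4 by clear -mu1; lra.
  have := dstar_lower_bound oD mu4 oreD v n1.
  rewrite -(ltr_nat R) natrD !natrM -/n mulrA -/L.
  by clear -XNR Nle gL n1; lra.
exists F; split=> //.
- split=> //; first last.
    rewrite ler_pM2r // -/r epsE expr2; have : 2 * l%:R * r <= 1 by clear -rl mu1 mu0; lra.
    by move=> h; rewrite mulrA -[leRHS]mul1r ler_wpM2r // ltW.
  have -> : 2 * l%:R * eps * n = l%:R * (2 * eps * n) by ring.
  by rewrite natrM ler_wpM2l.
(* The bad part of the cluster contributes at most [eps * m <= r * m], the good part at most
   [c + l <= 2 * r * m]. *)
- move=> i; have := card_bad_in eps0 eps1 rp pf i.
  have := VF i; rewrite -(ler_nat R) natrD => h1 h2.
  rewrite -(cardsID E (tiling_vertices F :&: V i)) natrD.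
  have h3 : #|tiling_vertices F :&: V i :&: E|%:R <= #|bad_in D D' eps m V f i|%:R :> R.
    rewrite ler_nat subset_leq_card //; apply: subset_trans (bad_set_cluster f rp i).
    by rewrite -setIA [V i :&: E]setIC subsetIr.
  have : eps * m%:R <= r * m%:R by rewrite ler_wpM2r.
  by rewrite -/r; clear -h1 h2 h3 cle lrm; lra.
Qed.
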